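(* For all $\varepsilon>0$, $$\mathbb{P}(Y\ge n) = O\left((\lambda_1+\varepsilon)^n\right),$$ with implied constant depending only on $p$ and $\varepsilon$ (not on $n$ or $N$). For $p=1/2$, $\lambda_1=\varphi/2$, where $\varphi=(1+\sqrt5)/2$ is the golden ratio. More precisely, for integers $n>1/\alpha'$, $$\mathbb{P}(Y\ge n)\le \left(\frac{2}{p^2}-\frac1p-1\right)e^{-(n-1)(\alpha'-1/n)} + \frac{2n\alpha' e^{-n\alpha'+1}}{\lambda_1},$$ where $\alpha'=\log(1/\lambda_1)$.
   Context: Fix a real number $0<p<1$ and an integer $N\ge 0$. Let $A$ be a random subset of $\{0,\dots,N\}$ in which each integer in $\{0,\dots,N\}$ is included independently with probability $p$, and let $A+A=\{a+b : a,b\in A\}$ ($a=b$ allowed). Let $Y=|\{0\le n\le N : n\notin A+A\}|$. Set $$\lambda_1=\frac{1-p+\sqrt{(1-p)(1+3p)}}{2}.$$ *)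

(* Defs.v *)
From mathcomp Require Import all_boot all_order all_algebra.
From mathcomp Require Import all_classical all_reals all_analysis.

Set Implicit Arguments.
Unset Strict Implicit.
Unset Printing Implicit Defensive.

Import Order.TTheory GRing.Theory Num.Theory.
Local Open Scope classical_set_scope.
Local Open Scope ring_scope.

(* The product rule is required for every finite subfamily; the case of an
   empty [J] reads [P setT = 1]. *)
Definition mutually_independent (d : measure_display) (T : measurableType d)
    (R : realType) (P : probability T R) (I : finType) (E : I -> set T) : Prop :=
  forall J : {set I},
    P (\bigcap_(i in [set` J]) E i) = (\prod_(i in J) P (E i))%E.

Definition random_subset (d : measure_display) (T : measurableType d)
    (R : realType) (P : probability T R) (p : R) (N : nat)
    (A : T -> {set 'I_N.+1}) : Prop :=
  [/\ forall i : 'I_N.+1, measurable [set w | i \in A w],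
      forall i : 'I_N.+1, P [set w | i \in A w] = p%:E
    & mutually_independent P (fun i : 'I_N.+1 => [set w | i \in A w])].

Definition in_sumset (N : nat) (S : {set 'I_N.+1}) (k : nat) : bool :=
  [exists a in S, exists b in S, (a + b)%N == k].

Definition missing_sums (N : nat) (S : {set 'I_N.+1}) : nat :=
  #|[pred k : 'I_N.+1 | ~~ in_sumset S k]|.

Definition lambda1 (R : realType) (p : R) : R :=
  (1 - p + Num.sqrt ((1 - p) * (1 + 3 * p))) / 2.

Definition alpha' (R : realType) (p : R) : R := ln (1 / lambda1 p).

Definition golden_ratio (R : realType) : R := (1 + Num.sqrt 5) / 2.

(* Main.v *)
Require Import Defs.
From mathcomp Require Import all_boot all_order all_algebra.
From mathcomp Require Import all_classical all_reals all_analysis.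
From mathcomp Require Import zify ring lra.

(** Write [lam] for [lambda1 p], the positive root of
[lam ^ 2 = (1 - p) * lam + p * (1 - p)], and [mu] for its square root.

The core is a bound for two missing sums: if [i] and [j] are distinct and at
most [N], then [i] and [j] are both missing from [A + A] with probability at
most [mu ^ (i + 1) * mu ^ (j + 1)] ([mass_missing2]).  Both are missing exactly
when [A] is an independent set of the graph on [{0, ..., N}] that joins [x] to
[y] when [x + y] is [i] or [j].  Every degree of this graph is at most two, and
it has no cycle apart from loops.  For such a graph the recurrence defining
[lam] gives, by removing vertices of degree at most one, that a random set is
independent with probability at most [mu] to the number of ordered adjacent
pairs ([indep_prob_le]); here there are [i + 1] pairs of sum [i] and [j + 1] of
sum [j].

The bound has a product form, so it can be summed over all pairs
([mass_missing_ge]).  If at least [n] sums are missing then, for every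
[m <= n], at least [m] of them are at least [n - m], which makes [m * (m - 1)]
ordered pairs; by Markov's inequality
[m * (m - 1) * P (Y >= n) <= lam ^ (n - m + 1) / (1 - mu) ^ 2].

With [m = 2] this is [P (Y >= n) = O (lam ^ n)], which is stronger than the first
claim.  For the explicit bound, let [a = alpha' p], so that
[lam = expR (- a)].  The second summand of the bound is
[2 * (n * a) * expR (1 - n * a) * expR a], the first is nonnegative, and the
second alone suffices ([tail_le_of_pair_moments]): it is at least [1] when
[n * a <= 5 / 2]; otherwise one takes for [m] the integer part of [2 / a], which
is roughly where [expR (a * m) / m ^ 2] is smallest, or [m = 2] when [a] is
not small. *)

Set Implicit Arguments.
Unset Strict Implicit.
Unset Printing Implicit Defensive.

Import Order.TTheory GRing.Theory Num.Theory.
Local Open Scope ring_scope.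

(** * Independent sets in graphs of degree at most two *)

Definition indep_set (V : finType) (e : rel V) (S : {set V}) : bool :=
  [forall x in S, forall y in S, ~~ e x y].

(** Only the vertices of [U] are drawn, each with probability [p]; this makes
deletion of a vertex a recursion on [U]. *)
Definition indep_prob (R : realType) (p : R) (V : finType) (e : rel V)
    (U : {set V}) : R :=
  \sum_(S : {set V} | S \subset U)
     (indep_set e S)%:R * (p ^+ #|S| * (1 - p) ^+ #|U :\: S|).

(** Ordered pairs: a loop counts once and any other edge twice. *)
Definition num_adj (V : finType) (e : rel V) (U : {set V}) : nat :=
  (\sum_(x in U) \sum_(y in U) e x y)%N.

Lemma leq_nat_of_bool (a b : bool) : (a -> b) -> (a <= b)%N.
Proof. by case: a b => [] [] // /(_ isT). Qed.

Section IndependentSets.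
Import mathcomp.boot.fintype mathcomp.boot.finset.
Context (R : realType) (p : R) (V : finType) (e : rel V).
Hypotheses (p_ge0 : 0 <= p) (p_le1 : p <= 1).
Hypothesis e_sym : symmetric e.

Local Notation Z := (@indep_prob R p V e).
Local Notation indep := (@indep_set V e).
Local Notation adj := (@num_adj V e).

Lemma indep_setP (S : {set V}) :
  reflect {in S &, forall x y, ~~ e x y} (indep S).
Proof.
apply: (iffP forall_inP) => [h x y xS yS|h x xS].
  exact: (forall_inP (h x xS)).
by apply/forall_inP => y yS; exact: h.
Qed.

Lemma indep_setW (S S' : {set V}) : S \subset S' -> indep S' -> indep S.
Proof.
move=> /subsetP sub /indep_setP h; apply/indep_setP => x y xS yS.
by apply: h; exact: sub.
Qed.

Lemma sum_subsetD1 (x : V) (U : {set V}) (F : {set V} -> R) : x \in U ->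
  \sum_(S : {set V} | S \subset U) F S =
  \sum_(S : {set V} | S \subset U :\ x) (F S + F (x |: S)).
Proof.
move=> xU; rewrite (bigID (fun S : {set V} => x \in S)) /= addrC big_split /=.
congr (_ + _).
  by apply: eq_bigl => S; rewrite subsetD1.
rewrite (reindex_onto (fun S => x |: S) (fun S => S :\ x)) /=; last first.
  by move=> S /andP[_ xS]; rewrite setD1K.
apply: eq_bigl => S; rewrite setU11 andbT subsetD1 subUset sub1set xU /=.
case: (boolP (x \in S)) => xS; last by rewrite setU1K ?eqxx // !andbT.
rewrite andbF; apply/negbTE/negP => /andP[_ /eqP h].
by have := setD11 x (x |: S); rewrite h xS.
Qed.

Lemma indep_prob_ge0 (U : {set V}) : 0 <= Z U.
Proof.
apply: sumr_ge0 => S _; rewrite mulr_ge0 // mulr_ge0 // exprn_ge0 //.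
by rewrite subr_ge0.
Qed.

(** Condition on whether [x] is drawn. *)
Lemma indep_probD1 (x : V) (U : {set V}) : x \in U ->
  Z U = (1 - p) * Z (U :\ x) +
    p * \sum_(S : {set V} | S \subset U :\ x)
       (indep (x |: S))%:R * (p ^+ #|S| * (1 - p) ^+ #|U :\ x :\: S|).
Proof.
move=> xU; rewrite /indep_prob (@sum_subsetD1 x) // big_split /= !mulr_sumr.
congr (_ + _); apply: eq_bigr => S; rewrite subsetD1 => /andP[SU xS].
  have -> : #|U :\: S| = #|U :\ x :\: S|.+1.
    have -> : U :\ x :\: S = (U :\: S) :\ x.
      by apply/setP => z; rewrite !inE; case: (z == x); rewrite ?andbF.
    by rewrite (cardsD1 x (U :\: S)) !inE xS xU.
  by rewrite exprS; ring.
by rewrite cardsU1 xS /= setDDl exprS; ring.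
Qed.

Lemma indep_prob_loop (x : V) (U : {set V}) : x \in U -> e x x ->
  Z U = (1 - p) * Z (U :\ x).
Proof.
move=> xU exx; rewrite (@indep_probD1 x) // big1 ?mulr0 ?addr0 // => S _.
case: (indep_setP (x |: S)) => [h|]; last by rewrite mul0r.
by have := h x x (setU11 _ _) (setU11 _ _); rewrite exx.
Qed.

Lemma indep_prob_le_D1 (x : V) (U : {set V}) : x \in U -> Z U <= Z (U :\ x).
Proof.
move=> xU; rewrite (@indep_probD1 x) //.
rewrite [leRHS](_ : _ = (1 - p) * Z (U :\ x) + p * Z (U :\ x)); last by ring.
rewrite lerD2l ler_wpM2l //; apply: ler_sum => S _.
apply: ler_wpM2r; first by rewrite mulr_ge0 // exprn_ge0 // subr_ge0.
by rewrite ler_nat leq_nat_of_bool //; apply: indep_setW; exact: subsetUr.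
Qed.

(** Condition on [x]: if [x] is drawn then its neighbour [y] is not. *)
Lemma indep_prob_leaf (x y : V) (U : {set V}) :
    x \in U -> y \in U :\ x -> e x y ->
  Z U <= (1 - p) * Z (U :\ x) + p * ((1 - p) * Z (U :\ x :\ y)).
Proof.
move=> xU yU exy; rewrite (@indep_probD1 x) // lerD2l ler_wpM2l //.
rewrite (@sum_subsetD1 y) // mulr_sumr; apply: ler_sum => S.
rewrite subsetD1 => /andP[SU yS].
have q0 : 0 <= 1 - p by rewrite subr_ge0.
have -> : indep (x |: (y |: S)) = false.
  by apply/negP => /indep_setP /(_ x y); rewrite !inE !eqxx orbT /= exy => /(_ isT isT).
rewrite mul0r addr0.
have -> : #|U :\ x :\: S| = #|U :\ x :\ y :\: S|.+1.
  have -> : U :\ x :\ y :\: S = (U :\ x :\: S) :\ y.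
    by apply/setP => z; rewrite !inE; case: (z == y); rewrite ?andbF.
  by rewrite (cardsD1 y (U :\ x :\: S)) [in LHS]inE yS yU.
rewrite exprS [leLHS](_ : _ = (1 - p) * ((indep (x |: S))%:R *
  (p ^+ #|S| * (1 - p) ^+ #|U :\ x :\ y :\: S|))); last by ring.
rewrite ler_wpM2l // ler_wpM2r ?mulr_ge0 ?exprn_ge0 //.
by rewrite ler_nat leq_nat_of_bool //; apply: indep_setW; exact: subsetUr.
Qed.

Lemma num_adjD1 (x : V) (U : {set V}) : x \in U ->
  adj U = (adj (U :\ x) + e x x + 2 * \sum_(y in U :\ x) e x y)%N.
Proof.
move=> xU; rewrite /num_adj (big_setD1 x) //= (big_setD1 x) //=.
under [X in (_ + X)%N]eq_bigr => y _ do rewrite (big_setD1 x) //= e_sym.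
by rewrite big_split /=; lia.
Qed.

(** Remove from [U] a vertex [x] of degree at most one in [U].  An isolated [x]
can be forgotten.  A loop at [x] multiplies the probability by [1 - p], which
is at most [mu].  If [x] has one neighbour [y], then removing [x] destroys two
ordered pairs and removing both destroys at most four, because the degree of
[y] is at most two.  The equation for [mu], which says that
[(1 - p) / mu ^ 2 + p * (1 - p) / mu ^ 4 = 1], is exactly what the two terms of
[indep_prob_leaf] require when [y] has another neighbour.  An even cycle of
length [L] would exceed [mu ^ (2 * L)]; the hypothesis that every nonempty set
has a vertex of degree at most one excludes cycles. *)
Lemma indep_prob_le (mu : R) : 0 < mu -> mu <= 1 ->
    mu ^+ 4 = (1 - p) * mu ^+ 2 + p * (1 - p) ->
    (forall x, \sum_y e x y <= 2)%N ->
    (forall U : {set V}, U != set0 ->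
       exists2 x, x \in U & (\sum_(y in U) e x y <= 1)%N) ->
  forall U : {set V}, Z U <= mu ^+ adj U.
Proof.
move=> mu_gt0 mu_le1 mu_eq deg2 leaf U.
have q0 : 0 <= 1 - p by rewrite subr_ge0.
have mu2_gt0 : 0 < mu ^+ 2 by rewrite exprn_gt0.
have mu2_ge : mu ^+ 2 * (mu ^+ 2 - (1 - p)) = p * (1 - p).
  by rewrite mulrBr -exprD mu_eq; ring.
have q_le : 1 - p <= mu ^+ 2.
  by rewrite -subr_ge0 -(pmulr_rge0 _ mu2_gt0) mu2_ge mulr_ge0.
have [n] := ubnP #|U|; elim: n U => // n IH U.
rewrite ltnS => Un.
have [->|/leaf[x xU degx]] := eqVneq U set0.
  rewrite /num_adj big_set0 expr0 /indep_prob (big_pred1 set0) => [|S].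
    by rewrite setD0 cards0 !expr0 !mulr1 lern1 leq_b1.
  by rewrite subset0.
have Ux : (#|U :\ x| < n)%N by move: Un; rewrite (cardsD1 x U) xU.
have adjU := num_adjD1 xU.
move: degx; rewrite (big_setD1 x) //=.
case: (boolP (e x x)) => exx degx.
  have deg0 : (\sum_(y in U :\ x) e x y = 0)%N.
    by move: degx; rewrite add1n ltnS leqn0 => /eqP.
  rewrite (@indep_prob_loop x) // adjU exx deg0 muln0 addn0 addn1 exprS.
  apply: ler_pM => //; first exact: indep_prob_ge0.
    apply: (le_trans q_le); rewrite expr2 ger_pMr //.
  exact: IH.
rewrite (negbTE exx) in adjU.
have [deg0|] := eqVneq (\sum_(y in U :\ x) e x y)%N 0%N.
  rewrite adjU deg0 !addn0; apply: le_trans (IH _ Ux).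
  exact: indep_prob_le_D1.
rewrite -lt0n lt0n sum_nat_eq0 negb_forall_in => /exists_inP[y yU].
rewrite eqb0 negbK => exy.
have deg1 : (\sum_(y in U :\ x) e x y = 1)%N.
  move: degx; rewrite (big_setD1 y) //= exy.
  by move: (\sum_(z in _) _)%N => s; clear; lia.
rewrite adjU deg1 addn0 exprD.
have adjUx := num_adjD1 yU.
have degy : (e y y + \sum_(z in U :\ x :\ y) e y z <= 1)%N.
  have := deg2 y; rewrite (bigD1 x) //= e_sym exy.
  have yx : y != x by move: yU; rewrite !inE => /andP[].
  rewrite (bigD1 y) //= (bigID (mem (U :\ x :\ y))) /=.
  rewrite (@eq_bigl _ _ _ _ _ _ (mem (U :\ x :\ y))) => [|z] /=.
    move: (\sum_(z in _) _)%N => s; move: (\sum_(z | _) _)%N => s'.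
    by case: (e y y); clear; lia.
  by rewrite !inE; case: (z == x); case: (z == y).
(* [c] counts the ordered pairs lost with [y] once [x] is gone. *)
set c := (e y y + 2 * \sum_(z in U :\ x :\ y) e y z)%N.
have c2 : (c <= 2)%N.
  rewrite /c; move: (\sum_(z in _) _)%N degy => s.
  by case: (e y y); clear; lia.
have adjUx' : adj (U :\ x) = (adj (U :\ x :\ y) + c)%N by rewrite adjUx -addnA.
have Uxy : (#|U :\ x :\ y| < n)%N.
  by apply: leq_ltn_trans Ux; rewrite subset_leq_card // subsetDl.
(* At [c = 2] this is the equation for [mu]; smaller [c] only helps. *)
have muc : p * (1 - p) <= mu ^+ c * (mu ^+ 2 - (1 - p)).
  rewrite -mu2_ge ler_wpM2r ?subr_ge0 //.
  by rewrite ler_wiXn2l // ltW.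
apply: (le_trans (indep_prob_leaf xU yU exy)).
apply: (@le_trans _ _ ((1 - p) * mu ^+ adj (U :\ x) +
    p * ((1 - p) * mu ^+ adj (U :\ x :\ y)))).
  by apply: lerD; rewrite ?ler_wpM2l //; exact: IH.
rewrite adjUx' exprD [leLHS](_ : _ = mu ^+ adj (U :\ x :\ y) *
  ((1 - p) * mu ^+ c + p * (1 - p))); last by ring.
rewrite -mulrA ler_wpM2l ?exprn_ge0 ?(ltW mu_gt0) //.
by rewrite muln1; move: muc; rewrite mulrBr => muc; nra.
Qed.
End IndependentSets.

(** * Two missing sums, and the number of pairs of missing sums *)

Definition sum_graph (N i j : nat) : rel 'I_N.+1 :=
  fun x y => ((x + y)%N == i) || ((x + y)%N == j).

Definition subset_mass (R : realType) (p : R) (N : nat) (S : {set 'I_N.+1}) : R :=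
  p ^+ #|S| * (1 - p) ^+ #|~: S|.

Section SumGraph.
Import mathcomp.boot.fintype mathcomp.boot.finset.

Lemma sum_graph_sym N i j : symmetric (@sum_graph N i j).
Proof. by move=> x y; rewrite /sum_graph addnC. Qed.

Lemma sum_addn_eq N k (x : 'I_N.+1) : (k <= N)%N ->
  (\sum_(y < N.+1) (x + y == k))%N = (x <= k)%N.
Proof.
move=> kN; have [xk|kx] := leqP x k.
  have h : (k - x < N.+1)%N by lia.
  rewrite (bigD1 (Ordinal h)) //= subnKC // eqxx big1 // => y /eqP yh.
  apply/eqP; rewrite eqb0; apply/eqP => e; apply: yh; apply: val_inj => /=; lia.
by rewrite big1 // => y _; apply/eqP; rewrite eqb0; apply/eqP; lia.
Qed.

Lemma sum_graph_bool N i j (x y : 'I_N.+1) : i != j ->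
  sum_graph i j x y = ((x + y == i) + (x + y == j))%N :> nat.
Proof.
rewrite /sum_graph => ij; have [->|] := eqVneq (x + y)%N i.
  by rewrite (negbTE ij).
by case: (_ == j).
Qed.

Lemma sum_graph_deg N i j (x : 'I_N.+1) : i != j -> (i <= N)%N -> (j <= N)%N ->
  (\sum_y sum_graph i j x y)%N = ((x <= i) + (x <= j))%N.
Proof.
move=> ij iN jN; under eq_bigr => y _ do rewrite sum_graph_bool //.
by rewrite big_split /= !sum_addn_eq.
Qed.

Lemma sum_leq_ord N k : (k <= N)%N -> (\sum_(x < N.+1) (x <= k))%N = k.+1.
Proof.
move=> kN; rewrite -(big_mkord xpredT (fun x => (x <= k : nat)%N)) /=.
rewrite (@big_cat_nat _ _ _ k.+1) //= [X in (_ + X)%N]big_nat_cond.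
rewrite [X in (_ + X)%N]big1 => [|x /andP[/andP[kx _] _]]; last first.
  by rewrite leqNgt kx.
rewrite addn0 (@eq_big_nat _ _ _ _ _ _ (fun=> 1%N)) => [|x]; last first.
  by case/andP => _; rewrite ltnS => ->.
by rewrite sum_nat_const_nat subn0 muln1.
Qed.

Lemma num_adj_sum_graph N i j : i != j -> (i <= N)%N -> (j <= N)%N ->
  num_adj (@sum_graph N i j) setT = (i.+1 + j.+1)%N.
Proof.
move=> ij iN jN; transitivity (\sum_x \sum_y @sum_graph N i j x y)%N.
  apply: eq_big => [x|x _]; first by rewrite inE.
  by apply: eq_bigl => y; rewrite inE.
under eq_bigr => x _ do rewrite sum_graph_deg //.
by rewrite big_split /= !sum_leq_ord.
Qed.

(** The vertex of [U] farthest from [(i + j) / 4] has degree at most one in [U].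
The two possible neighbours of [x] are its reflections in [i / 2] and in
[j / 2], and [(i + j) / 4] lies between these centres; so the reflection in the
centre on the side away from [x] is farther from [(i + j) / 4] than [x] is, and
is not in [U]. *)
Lemma sum_graph_leaf N i j (U : {set 'I_N.+1}) : (i < j)%N -> (j <= N)%N ->
  U != set0 -> exists2 x, x \in U & (\sum_(y in U) sum_graph i j x y <= 1)%N.
Proof.
move=> ij jN /set0Pn[x0 x0U].
pose dist (x : 'I_N.+1) := ((4 * x - (i + j)) + ((i + j) - 4 * x))%N.
case: (@arg_maxnP _ x0 (mem U) dist x0U) => x /= xU xmax.
exists x => //; have [xl|xr] := leqP (4 * x) (i + j).
  apply: (@leq_trans (\sum_(y < N.+1) (x + y == i))%N); last first.
    by rewrite sum_addn_eq ?leq_b1 //; lia.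
  rewrite [leqRHS](bigID (mem U)) /=; apply: leq_trans (leq_addr _ _).
  apply: leq_sum => y yU; rewrite sum_graph_bool; last by lia.
  have := xmax _ yU; rewrite /dist /= => h.
  by case: (eqVneq (x + y)%N j) => [e|]; lia.
apply: (@leq_trans (\sum_(y < N.+1) (x + y == j))%N); last first.
  by rewrite sum_addn_eq ?leq_b1.
rewrite [leqRHS](bigID (mem U)) /=; apply: leq_trans (leq_addr _ _).
apply: leq_sum => y yU; rewrite sum_graph_bool; last by lia.
have := xmax _ yU; rewrite /dist /= => h.
by case: (eqVneq (x + y)%N i) => [e|]; lia.
Qed.

Lemma indep_sum_graph N i j (S : {set 'I_N.+1}) :
  ~~ in_sumset S i -> ~~ in_sumset S j -> indep_set (@sum_graph N i j) S.
Proof.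
move=> /exists_inPn hi /exists_inPn hj; apply/indep_setP => x y xS yS.
rewrite negb_or; move/exists_inPn: (hi x xS) => -> //.
by move/exists_inPn: (hj x xS) => ->.
Qed.

Section Law.
Context (R : realType) (p mu : R).
Hypotheses (p_ge0 : 0 <= p) (p_le1 : p <= 1) (mu_gt0 : 0 < mu) (mu_lt1 : mu < 1).
Hypothesis mu_eq : mu ^+ 4 = (1 - p) * mu ^+ 2 + p * (1 - p).

Lemma subset_mass_ge0 N (S : {set 'I_N.+1}) : 0 <= subset_mass p S.
Proof. by rewrite mulr_ge0 // exprn_ge0 // subr_ge0. Qed.

(** The product form comes from counting ordered adjacent pairs: [i + 1] of them
have sum [i], and [j + 1] have sum [j]. *)
Lemma mass_missing2 N (i j : 'I_N.+1) : i != j ->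
  \sum_(S : {set 'I_N.+1} | ~~ in_sumset S i && ~~ in_sumset S j)
     subset_mass p S <= mu ^+ i.+1 * mu ^+ j.+1.
Proof.
wlog ij : i j / (i < j)%N => [hw ij|_].
  have [lij|ji|e] := ltngtP i j; [exact: hw lij ij|rewrite mulrC|].
    rewrite (eq_bigl _ _ (fun S => andbC _ _)).
    by apply: hw; rewrite // eq_sym.
  by move: ij; rewrite (val_inj e) eqxx.
have iN : (i <= N)%N by rewrite -ltnS.
have jN : (j <= N)%N by rewrite -ltnS.
rewrite -exprD -(num_adj_sum_graph (negbT (ltn_eqF ij)) iN jN).
apply: le_trans (indep_prob_le p_ge0 p_le1 (@sum_graph_sym _ i j) mu_gt0
  (ltW mu_lt1) mu_eq _ _ _).
- rewrite /indep_prob big_mkcond [leRHS]big_mkcond; apply: ler_sum => S _.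
  rewrite subsetT setTD -/(subset_mass p S).
  case: ifP => [/andP[hi hj]|_]; first by rewrite (indep_sum_graph hi hj) mul1r.
  by rewrite mulr_ge0 // subset_mass_ge0.
- by move=> x; rewrite sum_graph_deg ?(ltn_eqF ij) // (leq_add (leq_b1 _) (leq_b1 _)).
- by move=> U; exact: sum_graph_leaf.
Qed.

Lemma geometric_tail_le k M : (\sum_(i < M | (k <= i)%N) mu ^+ i) * (1 - mu) <= mu ^+ k.
Proof.
have mu0 := ltW mu_gt0.
suff : (\sum_(i < M | (k <= i)%N) mu ^+ i) * (1 - mu) <= mu ^+ k - mu ^+ maxn k M.
  by move=> /le_trans; apply; rewrite gerBl exprn_ge0.
rewrite big_mkcond; elim: M => [|M IH] /=.
  by rewrite big_ord0 mul0r maxn0 subrr.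
rewrite big_ord_recr /= mulrDl; have [kM|Mk] := leqP k M.
  move: IH; rewrite (maxn_idPr kM) (maxn_idPr (leqW kM)) exprS => IH; nra.
by move: IH; rewrite (maxn_idPl Mk) (maxn_idPl (ltnW Mk)) mul0r addr0.
Qed.

(** At most [n - m] of the missing sums are below [n - m], so at least [m] remain. *)
Lemma card_missing_pairs N (S : {set 'I_N.+1}) n m :
  (m <= n)%N -> (n <= missing_sums S)%N ->
  (m * m.-1 <= \sum_(i < N.+1 | (n - m <= i)%N) \sum_(j < N.+1 | (n - m <= j)%N && (i != j))
     (~~ in_sumset S i && ~~ in_sumset S j))%N.
Proof.
move=> mn nS.
pose M := [set i : 'I_N.+1 | ~~ in_sumset S i & (n - m <= i)%N].
have mM : (m <= #|M|)%N.
  have : (missing_sums S <= #|M| + (n - m))%N.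
    rewrite /missing_sums -(cardID [pred i : 'I_N.+1 | (n - m <= i)%N]
      [pred i : 'I_N.+1 | ~~ in_sumset S i]) leq_add //.
      apply: subset_leq_card; apply/subsetP => i; rewrite !inE //.
    apply: (@leq_trans #|[set i : 'I_N.+1 | (i < n - m)%N]|).
      by apply: subset_leq_card; apply/subsetP => i; rewrite !inE -ltnNge => /andP[].
    have -> : #|[set i : 'I_N.+1 | (i < n - m)%N]| = (\sum_(i < N.+1) (i < n - m))%N.
      by rewrite -sum1dep_card big_mkcond.
    case: (n - m)%N => [|k]; first by rewrite big1.
    have [kN|Nk] := leqP k N; first by rewrite sum_leq_ord.
    apply: (@leq_trans (\sum_(i < N.+1) 1)%N); first by apply: leq_sum => i _; exact: leq_b1.
    by rewrite sum1_card card_ord; lia.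
  by move: nS mn; lia.
apply: (@leq_trans (#|M| * #|M|.-1)%N); first by apply: leq_mul => //; lia.
rewrite -sum_nat_const.
rewrite [leqRHS](@bigID _ _ _ _ _ (fun i => ~~ in_sumset S (nat_of_ord i))) /=.
apply: leq_trans (leq_addr _ _).
rewrite [leqRHS](@eq_bigl _ _ _ _ _ _ (mem M)) => [|i]; last by rewrite !inE andbC.
apply: leq_sum => i iM.
have -> : #|M|.-1 = #|M :\ i| by rewrite (cardsD1 i M) iM.
rewrite -sum1_card [leqLHS]big_mkcond [leqRHS]big_mkcond; apply: leq_sum => j _.
move: iM; rewrite !inE (eq_sym i j) => /andP[-> _].
by case: (j == i); case: (in_sumset S j); case: (n - m <= j)%N.
Qed.

(** Markov's inequality for the number of ordered pairs of distinct missing sums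
that are at least [n - m]. *)
Lemma mass_missing_ge N n m : (m <= n)%N ->
  (m * m.-1)%:R * \sum_(S : {set 'I_N.+1} | (n <= missing_sums S)%N) subset_mass p S
    <= (mu ^+ (n - m).+1 / (1 - mu)) ^+ 2.
Proof.
move=> mn.
have mu0 := ltW mu_gt0.
set k := (n - m)%N.
apply: (@le_trans _ _ (\sum_(S : {set 'I_N.+1}) \sum_(i < N.+1 | (k <= i)%N)
   \sum_(j < N.+1 | (k <= j)%N && (i != j))
     (~~ in_sumset S i && ~~ in_sumset S j)%:R * subset_mass p S)).
  rewrite mulr_sumr big_mkcond; apply: ler_sum => S _.
  under eq_bigr => i _ do rewrite -mulr_suml -natr_sum.
  rewrite -mulr_suml -natr_sum; case: ifP => nS.
    by rewrite ler_wpM2r ?subset_mass_ge0 // ler_nat card_missing_pairs.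
  by rewrite mulr_ge0 // subset_mass_ge0.
rewrite exchange_big /=.
apply: (@le_trans _ _ ((\sum_(i < N.+1 | (k <= i)%N) mu ^+ i.+1) ^+ 2)).
  rewrite expr2 mulr_suml; apply: ler_sum => i ki.
  rewrite exchange_big /= mulr_sumr.
  apply: (@le_trans _ _ (\sum_(j < N.+1 | (k <= j)%N && (i != j))
      mu ^+ i.+1 * mu ^+ j.+1)).
    apply: ler_sum => j /andP[_ ij]; apply: le_trans (mass_missing2 ij).
    by rewrite [leRHS]big_mkcond; apply: ler_sum => S _; case: ifP => _;
      rewrite ?mul1r ?mul0r.
  rewrite [leRHS](bigID (fun j => i != j)) /= lerDl; apply: sumr_ge0 => j _.
  by rewrite mulr_ge0 // exprn_ge0.
rewrite lerXn2r ?nnegrE //.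
- by apply: sumr_ge0 => i _; rewrite exprn_ge0.
- by rewrite divr_ge0 ?exprn_ge0 // subr_ge0 ltW.
rewrite ler_pdivlMr ?subr_gt0 // exprS.
under eq_bigr => i _ do rewrite exprS.
by rewrite -mulr_sumr -mulrA ler_wpM2l // geometric_tail_le.
Qed.
End Law.
End SumGraph.

(** * The law of a random subset *)

Local Open Scope classical_set_scope.
Local Open Scope ring_scope.

Section RandomSubset.
Context (R : realType) (p : R) (N : nat) (d : measure_display)
  (T : measurableType d) (P : probability T R) (A : T -> {set 'I_N.+1}).
Hypothesis rsA : random_subset P p A.

Let cylinder (J K : {set 'I_N.+1}) : set T :=
  [set w | {subset J <= A w} /\ forall i, i \in K -> i \notin A w].

Lemma measurable_cylinder (J K : {set 'I_N.+1}) : measurable (cylinder J K).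
Proof.
have [mA _ _] := rsA.
have -> : cylinder J K =
    (\bigcap_(i in [set` J]) [set w | i \in A w]) `&`
    (\bigcap_(i in [set` K]) ~` [set w | i \in A w]).
  apply/seteqP; split => w /= [JA KA]; split => i iJ; first exact: JA.
  - exact/negP/KA.
  - exact: JA.
  - exact/negP/KA.
by apply: measurableI; apply: fin_bigcap_measurable => // i _; exact: measurableC.
Qed.

(** Independence is given for the events that points belong to [A w]; induction
on [#|K|] extends it to points that do not, the event for [K] being that for
[K :\ x] minus its part where [x] belongs to [A w]. *)
Lemma prob_cylinder (J K : {set 'I_N.+1}) : (forall i, i \in J -> i \notin K) ->
  P (cylinder J K) = (p ^+ #|J| * (1 - p) ^+ #|K|)%:E.
Proof.
have [mA pA indA] := rsA.
have [n] := ubnP #|K|; elim: n J K => // n IH J K; rewrite ltnS => Kn JK.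
have [->|/finset.set0Pn[x xK]] := eqVneq K finset.set0.
  have -> : cylinder J finset.set0 = \bigcap_(i in [set` J]) [set w | i \in A w].
    apply/seteqP; split => w /=.
      by move=> [JA _] i /= /JA.
    by move=> JA; split => [i /JA|i]; rewrite ?inE.
  by rewrite indA (eq_bigr (fun=> p%:E)) // finset.cards0 expr0 mulr1 prodEFin prodr_const.
have xJ : x \notin J by apply: contraL xK; exact: JK.
have cardK : #|K| = #|(K :\ x)%SET|.+1 by rewrite (finset.cardsD1 x) xK.
have JK' i : i \in J -> i \notin (K :\ x)%SET.
  by move=> /JK iK; rewrite !inE (negbTE iK) andbF.
have JK'' i : i \in (x |: J)%SET -> i \notin (K :\ x)%SET.
  by rewrite !inE; case: eqVneq => //= _ /JK.
have : P (cylinder J (K :\ x)%SET) =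
    (P (cylinder J (K :\ x)%SET `\` [set w | x \in A w]) +
     P (cylinder J (K :\ x)%SET `&` [set w | x \in A w]))%E.
  exact: measureDI (measurable_cylinder _ _) (mA x).
have -> : cylinder J (K :\ x)%SET `\` [set w | x \in A w] = cylinder J K.
  apply/seteqP; split => w /=.
    move=> [[JA KA] /negP xA]; split => // i iK.
    by have [->//|ix] := eqVneq i x; apply: KA; rewrite !inE ix.
  move=> [JA KA]; split; last exact/negP/KA.
  by split => // i; rewrite !inE => /andP[_ /KA].
have -> : cylinder J (K :\ x)%SET `&` [set w | x \in A w] =
    cylinder (x |: J)%SET (K :\ x)%SET.
  apply/seteqP; split => w /=.
    move=> [[JA KA] xA]; split => // i; rewrite !inE.
    by case: eqVneq => [-> _ //|_ /JA].
  move=> [JA KA]; split; last by apply: JA; rewrite finset.setU11.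
  by split => // i iJ; apply: JA; rewrite !inE iJ orbT.
have Kxn : (#|(K :\ x)%SET| < n)%N by rewrite -cardK.
rewrite (IH _ _ Kxn JK') (IH _ _ Kxn JK'') cardK finset.cardsU1 xJ.
rewrite -[P (cylinder J K)]fineK ?fin_num_measure //; last exact: measurable_cylinder.
rewrite -EFinD => -[h]; congr EFin; move: h; rewrite add1n !exprS.
set u := fine _; set v := p ^+ _; set z := (1 - p) ^+ _ => h.
by have -> : u = v * z - p * v * z; [rewrite h | ]; ring.
Qed.

Lemma cylinder_compl (S : {set 'I_N.+1}) :
  cylinder S (~: S)%SET = [set w | A w = S].
Proof.
apply/seteqP; split => w /=.
  move=> [SA SA']; apply/finset.setP => i; apply/idP/idP => [iA|/SA//].
  by apply: contraT => iS; have := SA' i; rewrite inE iS iA => /(_ isT).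
by move=> <-; split => // i; rewrite inE.
Qed.

Lemma prob_random_subset (Q : pred {set 'I_N.+1}) :
  P [set w | Q (A w)] = (\sum_(S | Q S) subset_mass p S)%:E.
Proof.
have -> : [set w | Q (A w)] = \bigcup_(S in [set` Q]) [set w | A w = S].
  apply/seteqP; split => w /=; first by move=> QA; exists (A w).
  by case=> S QS ->.
have mA S : measurable [set w | A w = S].
  by rewrite -cylinder_compl; exact: measurable_cylinder.
rewrite measure_fin_bigcup //; last first.
  by move=> S S' _ _ [w [/= <- <-]].
have -> : [set` Q] = [set` enum Q].
  by apply/seteqP; split => S /=; rewrite mem_enum.
rewrite -fsbig_seq ?enum_uniq // big_enum /= -sumEFin; apply: eq_bigr => S _.
rewrite -cylinder_compl prob_cylinder // => i iS.
by rewrite inE iS.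
Qed.
End RandomSubset.

(** * Numerical estimates *)

Section Numeric.
Context (R : realType).

Lemma lambda1P (p : R) : 0 < p -> p < 1 ->
  [/\ 0 < lambda1 p, lambda1 p < 1 &
      lambda1 p ^+ 2 = (1 - p) * lambda1 p + p * (1 - p)].
Proof.
move=> p0 p1; rewrite /lambda1; set s := Num.sqrt _.
have s0 : 0 <= s by exact: sqrtr_ge0.
have s2 : s ^+ 2 = (1 - p) * (1 + 3 * p) by rewrite sqr_sqrtr //; nra.
split; [lra| |].
  have : s < 1 + p by nra.
  lra.
have -> : ((1 - p + s) / 2) ^+ 2 = ((1 - p) ^+ 2 + 2 * (1 - p) * s + s ^+ 2) / 4.
  by field.
by rewrite s2; field.
Qed.

Lemma lambda1_half : lambda1 (1 / 2 : R) = golden_ratio R / 2.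
Proof.
rewrite /lambda1 /golden_ratio.
have -> : (1 - 1 / 2) * (1 + 3 * (1 / 2)) = (1 / 2) ^+ 2 * 5 :> R by field.
by rewrite sqrtrM ?sqr_ge0 // sqrtr_sqr ger0_norm; [field|lra].
Qed.

Lemma expR_le_inv (x : R) : x < 1 -> expR x <= (1 - x)^-1.
Proof.
move=> x1; rewrite -[x in leLHS]opprK expRN lef_pV2 ?posrE ?expR_gt0 ?subr_gt0 //.
exact: expR_ge1Dx.
Qed.

Lemma expR_3half_le : expR (3 / 2 : R) <= 5.
Proof.
have -> : (3 / 2 : R) = 16%:R * (3 / 32) by field.
rewrite expRM_natl; apply: (@le_trans _ _ ((32 / 29) ^+ 16)); last by lra.
rewrite lerXn2r ?nnegrE ?expR_ge0 ?divr_ge0 //.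
have -> : (32 / 29 : R) = (1 - 3 / 32)^-1 by field.
by apply: expR_le_inv; lra.
Qed.

Lemma expR1_ge : (5 / 2 : R) <= expR 1.
Proof.
have -> : (1 : R) = 8%:R * (1 / 8) by field.
rewrite expRM_natl; apply: (@le_trans _ _ ((1 + 1 / 8) ^+ 8)); first by lra.
by rewrite lerXn2r ?nnegrE ?expR_ge0 ?addr_ge0 ?divr_ge0 // expR_ge1Dx.
Qed.

(** The line is above [5 / (1 + (3 / 2 - y))], an upper bound of [expR y]; the two
meet at both ends of the interval. *)
Lemma expR_le_linear (y : R) : 0 <= y -> y <= 3 / 2 -> expR y <= 2 + 2 * y.
Proof.
move=> y0 y1; have h := expR_ge1Dx (3 / 2 - y).
have E : expR y * expR (3 / 2 - y) <= 5.
  by rewrite -expRD addrC subrK expR_3half_le.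
have := expR_gt0 y; nra.
Qed.

(** Here [t] is the probability that [n] sums are missing and [expR (- a)] is the
decay rate.  Up to [n * a = 5 / 2] the right-hand side is at least [1].  Beyond
that its factor [2 * (n * a)] is at least [5], and it is enough to choose [m]
with
[expR (a * (m - 2)) <= 5 * expR 1 * (1 - expR (- (a / 2))) ^ 2 * m * (m - 1)]. *)
Lemma tail_le_of_pair_moments (a t : R) (n : nat) :
    0 < a -> 0 <= t -> t <= 1 -> 1 < n%:R * a ->
    (forall m, (m <= n)%N -> (m * m.-1)%:R * t
        <= (expR (- (a / 2)) ^+ (n - m).+1 / (1 - expR (- (a / 2)))) ^+ 2) ->
  t <= 2 * (n%:R * a) * expR (1 - n%:R * a) * expR a.
Proof.
move=> a0 t0 t1 na pairs.
set x := n%:R * a in na *.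
have mu1 : 0 < 1 - expR (- (a / 2)) by rewrite subr_gt0 expR_lt1; lra.
have [x_le|x_gt] := leP x (5 / 2).
  apply: (le_trans t1).
  have ex : expR (x - 1) <= 2 * x by have := @expR_le_linear (x - 1); lra.
  have := expRxMexpNx_1 (x - 1); rewrite opprB => e1.
  have := expR_ge1Dx a; have := expR_gt0 (1 - x); have := expR_gt0 (x - 1).
  move=> h1 h2 h3.
  have : 1 <= 2 * x * expR (1 - x) by nra.
  by nra.
(* Two missing sums require [n >= 2]; for [n = 1] the bound is at least [1]. *)
have [n2|n1] := ltnP 1 n; last first.
  have xa : x <= a by rewrite /x ger_pMl // lern1.
  apply: (le_trans t1).
  rewrite -mulrA -expRD.
  have h := expR_ge1Dx (1 - x + a); nra.
have key m : (2 <= m)%N -> (m <= n)%N ->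
    expR (a * (m%:R - 2)) <= 5 * expR 1 * ((1 - expR (- (a / 2))) ^+ 2 * (m * m.-1)%:R) ->
    t <= 2 * x * expR (1 - x) * expR a.
  move=> m2 mn hm.
  have mm0 : 0 < (m * m.-1)%:R :> R by rewrite ltr0n muln_gt0; lia.
  have mupos : 0 < (1 - expR (- (a / 2))) ^+ 2 by rewrite exprn_gt0.
  have := pairs m mn; rewrite exprMn exprVn -exprM ler_pdivlMr // -expRM_natl.
  have -> : ((n - m).+1 * 2)%:R * - (a / 2) = a * (m%:R - 2) + (a - x).
    by rewrite natrM -addn1 natrD natrB // /x; field.
  rewrite expRD => h1.
  have h2 : expR (a * (m%:R - 2)) * expR (a - x) <=
     5 * expR 1 * ((1 - expR (- (a / 2))) ^+ 2 * (m * m.-1)%:R) * expR (a - x).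
    by rewrite ler_wpM2r ?expR_ge0.
  have E : expR (1 - x) * expR a = expR 1 * expR (a - x).
    by rewrite -!expRD; congr expR; ring.
  rewrite -(mulrA _ (expR _)) E.
  have := le_trans h1 h2.
  rewrite [leLHS](_ : _ = ((1 - expR (- (a / 2))) ^+ 2 * (m * m.-1)%:R) * t); last by ring.
  rewrite [leRHS](_ : _ = ((1 - expR (- (a / 2))) ^+ 2 * (m * m.-1)%:R) *
    (5 * (expR 1 * expR (a - x)))); last by ring.
  rewrite ler_pM2l ?mulr_gt0 // => /le_trans; apply.
  rewrite ler_wpM2r ?mulr_ge0 ?expR_ge0 //; lra.
have e1 := expR1_ge.
have mu_le : expR (- (a / 2)) <= (1 + a / 2)^-1.
  by have := @expR_le_inv (- (a / 2)); rewrite opprK; apply; lra.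
have [a_ge|a_lt] := leP (1 / 2) a.
  apply: (key 2%N) => //; rewrite subrr mulr0 expR0.
  have : expR (- (a / 2)) <= 4 / 5.
    apply: (le_trans mu_le); rewrite -[leRHS]invf_div lef_pV2 ?posrE; lra.
  move=> h; have h2 : 1 / 5 * (1 / 5) <= (1 - expR (- (a / 2))) ^+ 2.
    by rewrite expr2; apply: ler_pM; lra.
  have : 5 / 2 * (1 / 5 * (1 / 5)) <= expR 1 * (1 - expR (- (a / 2))) ^+ 2.
    by apply: ler_pM => //; lra.
  by rewrite /=; lra.
(* For small [a] the choice is [m = truncn (2 / a)], so that [m * a] is in
   the interval from [2 - a] to [2]; it is at most [n] because [n * a > 5 / 2]. *)
have a2 : 0 <= 2 / a by rewrite divr_ge0 // ltW.
have /andP[mle mgt] := truncn_itv a2.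
set m := Num.truncn _ in mle mgt; clearbody m.
have mle' : m%:R * a <= 2 by rewrite -ler_pdivlMr.
have mgt' : 2 < (m%:R + 1) * a by rewrite -ltr_pdivrMr // natr1.
have m4 : (3 < m)%N.
  by rewrite -(ltr_nat R) -(ltr_pM2r a0); nra.
apply: (key m).
- exact: ltn_trans m4.
- by rewrite -(ler_nat R) -(ler_pM2r a0) -/x; lra.
have -> : (m * m.-1)%:R = m%:R * (m%:R - 1) :> R.
  by case: (m) m4 => [//|k] _; rewrite natrM -natr1 addrK.
(* With [1 - mu >= a / (2 + a)] and [m * a >= 2 - a] the condition on [m] reduces
   to [4 * (2 + a) ^ 2 <= 5 * (2 - a) * (2 - 2 * a) * (1 + 2 * a) ^ 2]; on
   [a < 1 / 2] the difference is a sum of terms that are visibly nonnegative. *)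
have h1 : (a / (2 + a)) ^+ 2 <= (1 - expR (- (a / 2))) ^+ 2.
  rewrite lerXn2r ?nnegrE ?divr_ge0 //; [lra..|].
  have -> : a / (2 + a) = 1 - (1 + a / 2)^-1 by field; lra.
  by lra.
have h2 : (2 - a) * (2 - 2 * a) <= a ^+ 2 * (m%:R * (m%:R - 1)).
  rewrite [leRHS](_ : _ = (m%:R * a) * (m%:R * a - a)); last by ring.
  by apply: ler_pM; lra.
have h3 : expR (a * (m%:R - 2)) <= expR (1 - 2 * a) * expR 1.
  by rewrite -expRD ler_expR mulrBr mulrC; lra.
have h4 : expR (1 - 2 * a) <= 4 / (1 + 2 * a) ^+ 2.
  have -> : 1 - 2 * a = 2%:R * (1 / 2 - a) by field.
  rewrite expRM_natl [leRHS](_ : _ = ((1 - (1 / 2 - a))^-1) ^+ 2).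
    rewrite lerXn2r ?nnegrE ?expR_ge0 ?invr_ge0 //; first by lra.
    by apply: expR_le_inv; lra.
  by field; lra.
have h5 : 4 / (1 + 2 * a) ^+ 2 <= 5 * ((a / (2 + a)) ^+ 2 * (m%:R * (m%:R - 1))).
  apply: (@le_trans _ _ (5 * ((2 - a) * (2 - 2 * a) / (2 + a) ^+ 2))).
    rewrite ler_pdivrMr ?exprn_gt0 //; last by lra.
    rewrite mulrA mulrAC ler_pdivlMr ?exprn_gt0 //; last by lra.
    have b1 : 0 <= a * (1 / 2 - a) by rewrite mulr_ge0; lra.
    have b2 : 0 <= a * ((1 / 2 - a) * (1 / 2 + a)) by rewrite !mulr_ge0; lra.
    have b3 : 0 <= a ^+ 4 by rewrite exprn_ge0 // ltW.
    rewrite -subr_ge0 [leRHS](_ : _ = 40 * a ^+ 4 + 34 * (a * (1 / 2 - a)) +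
      80 * (a * ((1 / 2 - a) * (1 / 2 + a))) + (4 - 3 * a)); last by field.
    by lra.
  rewrite ler_wpM2l // ler_pdivrMr ?exprn_gt0 //; last by lra.
  rewrite [leRHS](_ : _ = a ^+ 2 * (m%:R * (m%:R - 1))) //.
  by field; lra.
have m2 : 0 <= m%:R * (m%:R - 1) :> R.
  by rewrite mulr_ge0 // subr_ge0 ler1n (ltn_trans _ m4).
apply: (le_trans h3); rewrite -mulrA mulrCA mulrC ler_wpM2l ?expR_ge0 //.
apply: (le_trans h4); apply: (le_trans h5).
by rewrite ler_wpM2l // ler_wpM2r.
Qed.
End Numeric.

(** * The tail of the number of missing sums *)

(** The probability is handed over as a real number [t], the form in which the
numerical estimates use it. *)
Lemma prob_missing_tail (R : realType) (p mu : R) (N n : nat)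
    (d : measure_display) (T : measurableType d) (P : probability T R)
    (A : T -> {set 'I_N.+1}) :
    0 <= p -> p <= 1 -> 0 < mu -> mu < 1 ->
    mu ^+ 4 = (1 - p) * mu ^+ 2 + p * (1 - p) -> random_subset P p A ->
  exists t : R,
    [/\ P [set w | (n <= missing_sums (A w))%N] = t%:E, 0 <= t, t <= 1 &
      forall m, (m <= n)%N ->
        (m * m.-1)%:R * t <= (mu ^+ (n - m).+1 / (1 - mu)) ^+ 2].
Proof.
move=> p0 p1 mu0 mu1 mu_eq rsA.
pose Q := [pred S : {set 'I_N.+1} | (n <= missing_sums S)%N].
exists (\sum_(S | Q S) subset_mass p S); split.
- exact: (prob_random_subset rsA Q).
- by apply: sumr_ge0 => S _; exact: subset_mass_ge0.
- have := prob_random_subset rsA xpredT.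
  rewrite (_ : [set w | _] = setT); last by apply/seteqP; split.
  rewrite probability_setT => -[->]; rewrite big_mkcond; apply: ler_sum => S _.
  by case: ifP => // _; exact: subset_mass_ge0.
- by move=> m mn; exact: mass_missing_ge.
Qed.

Unset Implicit Arguments.

Theorem corollary4p5 (R : realType) (p : R) (p_gt0 : 0 < p) (p_lt1 : p < 1) :
  [/\ forall eps : R, 0 < eps ->
        exists C : R,
          forall (N n : nat) (d : measure_display) (T : measurableType d)
            (P : probability T R) (A : T -> {set 'I_N.+1}),
            random_subset P p A ->
            (P [set w | (n <= missing_sums (A w))%N]
               <= (C * (lambda1 p + eps) ^+ n)%:E)%E,
      p = 1 / 2 -> lambda1 p = golden_ratio R / 2
    & forall (N n : nat) (d : measure_display) (T : measurableType d)
        (P : probability T R) (A : T -> {set 'I_N.+1}),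
        random_subset P p A ->
        1 / alpha' p < n%:R ->
        (P [set w | (n <= missing_sums (A w))%N]
           <= ((2 / p ^+ 2 - 1 / p - 1)
                 * expR (- (n%:R - 1) * (alpha' p - 1 / n%:R))
               + 2 * n%:R * alpha' p * expR (- n%:R * alpha' p + 1)
                 / lambda1 p)%:E)%E].
Proof.
have [lam0 lam1 lam_eq] := lambda1P p_gt0 p_lt1.
have p0 := ltW p_gt0; have p1 := ltW p_lt1.
have a0 : 0 < alpha' p by rewrite /alpha' ln_gt0 // ltr_pdivlMr // mul1r.
have ea : expR (alpha' p) = 1 / lambda1 p by rewrite lnK // posrE divr_gt0.
pose mu := expR (- (alpha' p / 2)).
have mu0 : 0 < mu by exact: expR_gt0.
have mu1 : mu < 1 by rewrite expR_lt1; lra.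
have mu2 : mu ^+ 2 = lambda1 p.
  rewrite -expRM_natl (_ : _ * _ = - alpha' p); last by field.
  by rewrite expRN ea; field; rewrite gt_eqF.
have mu_eq : mu ^+ 4 = (1 - p) * mu ^+ 2 + p * (1 - p).
  by rewrite -[4%N]/(2 * 2)%N exprM mu2.
have imu : 0 < 1 - mu by rewrite subr_gt0.
split.
- move=> eps eps0; exists ((lambda1 p)^-1 / (1 - mu) ^+ 2) => N n d T P A rsA.
  have [t [-> t0 t1 pairs]] := prob_missing_tail n p0 p1 mu0 mu1 mu_eq rsA.
  rewrite lee_fin; apply: (@le_trans _ _ ((lambda1 p)^-1 / (1 - mu) ^+ 2 * lambda1 p ^+ n)).
    have [n2|n1] := ltnP 1 n.
      have := pairs 2%N n2; rewrite /= muln1 expr_div_n -exprM mulnC exprM mu2.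
      have -> : ((n - 2).+1 = n.-1)%N by lia.
      move=> h; apply: (@le_trans _ _ (2 * t)); first by lra.
      apply: (le_trans h).
      rewrite -[n in leRHS](ltn_predK n2) [lambda1 p ^+ _.+1]exprS mulrACA mulVf ?gt_eqF //.
      by rewrite mul1r mulrC.
    apply: (le_trans t1); rewrite mulrAC.
    rewrite ler_pdivlMr ?exprn_gt0 // mul1r.
    apply: (@le_trans _ _ 1); first by rewrite expr_le1 //; lra.
    rewrite -ler_pdivrMl ?invr_gt0 // invrK mulr1.
    by case: n n1 {pairs} => [|[|//]] _; rewrite ?expr0 ?expr1 // ltW.
  rewrite ler_wpM2l ?divr_ge0 ?invr_ge0 ?exprn_ge0 //; [exact: ltW..|].
  by rewrite lerXn2r ?nnegrE //; lra.
- by move=> ->; exact: lambda1_half.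
- move=> N n d T P A rsA na.
  have [t [-> t0 t1 pairs]] := prob_missing_tail n p0 p1 mu0 mu1 mu_eq rsA.
  rewrite lee_fin.
  have na' : 1 < n%:R * alpha' p by rewrite -ltr_pdivrMr.
  have := tail_le_of_pair_moments a0 t0 t1 na' pairs; rewrite ea => h.
  have c0 : 0 <= 2 / p ^+ 2 - 1 / p - 1.
    rewrite (_ : _ - 1 = (1 - p) * (2 + p) / p ^+ 2); last by field; rewrite gt_eqF.
    by rewrite divr_ge0 ?exprn_ge0 // mulr_ge0; lra.
  apply: (le_trans h); rewrite -[leLHS]add0r; apply: lerD.
    by rewrite mulr_ge0 // expR_ge0.
  by rewrite mulNr addrC !mulrA mulr1.
Qed.
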